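(* Suppose the interface $\Gamma$ is polygonal (polyhedral if $d=3$). Then there exist a constant $h_1>0$ and a constant $C>0$, independent of $h$ and of how $\Gamma$ cuts the mesh, such that for every mesh $\mathcal T_h$ as in the context with $h<h_1$, $$\|w\|_{L^\infty(\Gamma_K)}\le C\,h_K^{(1-d)/2}\,\|w\|_{L^2(\Gamma_{B_{\tau(K)}})},\qquad\forall w\in\mathbb P_m(B_{\tau(K)}),\ \forall K\in\mathcal T_h^\Gamma.$$
   Context: $\Omega\subset\mathbb R^d$ ($d=2,3$) is an open polygonal (polyhedral) domain, and $\Gamma\Subset\Omega$ is an interface separating $\Omega$ into two disjoint subdomains $\Omega_0,\Omega_1$ with $\overline\Omega_0\cup\overline\Omega_1=\overline\Omega$. $\mathcal T_h$ is a partition of $\Omega$ into triangles (tetrahedra), not required to be aligned with $\Gamma$; $h_K$ is the diameter of $K$, $\rho_K$ the radius of its largest inscribed ball, $h=\max_Kh_K$, $\rho=\min_K\rho_K$, and $h\le C_\nu\rho$ with $C_\nu$ independent of $h$ (quasi-uniformity). $\mathcal T_h^\Gamma=\{K\in\mathcal T_h:K\cap\Gamma\ne\varnothing\}$ is the set of cut elements. Standing assumptions: no closed cut element meets $\partial\Omega$, and for every $K\in\mathcal T_h^\Gamma$ and $i=0,1$ there is an element $K'\in\mathcal T_h$ with $K'\subset\Omega_i$ and $\overline{K'}\cap\overline K\neq\varnothing$. $\Gamma_1,\dots,\Gamma_J$ are the sides of $\Gamma$ (line segments if $d=2$, polygons if $d=3$). For $K\in\mathcal T_h^\Gamma$: $\Gamma_K=K\cap\Gamma$,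 $\mathbf x_K$ is the barycenter of $K$, $B_{\tau(K)}=B(\mathbf x_K,h_K)$ is the ball of radius $h_K$ centered at $\mathbf x_K$, and, if $\Gamma_{k_1},\dots,\Gamma_{k_{J_K}}$ are the sides of $\Gamma$ that intersect $K$, $\Gamma_{B_{\tau(K)}}=\bigcup_{1\le j\le J_K}(\Gamma_{k_j}\cap B_{\tau(K)})$. $m\ge1$ is a fixed integer and $\mathbb P_m(D)$ is the space of polynomials of degree at most $m$ on $D$. *)

(* Defs.v *)
From HB Require Import structures.
From mathcomp Require Import all_boot all_order all_algebra.
From mathcomp Require mpoly.

(* The notations of mpoly and of MathComp-Analysis cannot be in scope together;
   msize is the total degree plus one, and 0 for the zero polynomial. *)
Module MPoly.
Import mpoly.
Definition degree_le {R : nzRingType} {n : nat} (m : nat) (p : {mpoly R[n]}) : Prop :=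
  (msize p <= m.+1)%N.
End MPoly.

From mathcomp Require Import all_classical all_reals all_analysis.

Set Implicit Arguments.
Unset Strict Implicit.
Unset Printing Implicit Defensive.

Import Order.TTheory GRing.Theory Num.Theory.
Import numFieldTopology.Exports numFieldNormedType.Exports.

Local Open Scope classical_set_scope.
Local Open Scope ring_scope.

(* 'M[R]_(m, n) carries the Borel sigma-algebra. *)
Definition mx_borel_display : measure_display. Proof. exact. Qed.

Section mx_borel.
Variables (R : realType) (m n : nat).

Let borel : set (set 'M[R]_(m, n)) := <<s open >>.

Let borel0 : borel set0. Proof. exact: sigma_algebra0. Qed.

Let borelC A : borel A -> borel (~` A).
Proof. exact: sigma_algebraC. Qed.

Let borel_bigcup (F : (set 'M[R]_(m, n))^nat) :
  (forall i, borel (F i)) -> borel (\bigcup_i F i).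
Proof. exact: sigma_algebra_bigcup. Qed.

HB.instance Definition _ := @isMeasurable.Build mx_borel_display
  'M[R]_(m, n) borel borel0 borelC borel_bigcup.

End mx_borel.

Section lebesgue_rV.
Variable R : realType.

Lemma open_measurable_mx m n (A : set 'M[R]_(m, n)) : open A -> measurable A.
Proof. exact: sub_sigma_algebra. Qed.

Lemma closed_measurable_mx m n (A : set 'M[R]_(m, n)) :
  closed A -> measurable A.
Proof.
move=> cA; rewrite -[A]setCK; apply: measurableC; apply: open_measurable_mx.
exact: closed_openC.
Qed.

Lemma continuous_measurable_mx m n p q (f : 'M[R]_(m, n) -> 'M[R]_(p, q)) :
  continuous f -> measurable_fun setT f.
Proof.
move=> cf; apply: (measurability (@open 'M[R]_(p, q))) => // _ [B oB <-].
by rewrite setTI; apply: open_measurable_mx; exact: open_comp.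
Qed.

Definition cons_rV n (p : R * 'rV[R]_n) : 'rV[R]_n.+1 :=
  row_mx (p.1%:M : 'rV_1) p.2.

Lemma cons_rV0 n (p : R * 'rV[R]_n) : cons_rV p 0 ord0 = p.1.
Proof.
by rewrite /cons_rV mxE; case: splitP => // j _; rewrite ord1 mxE eqxx mulr1n.
Qed.

Lemma cons_rVS n (p : R * 'rV[R]_n) j : cons_rV p 0 (lift ord0 j) = p.2 0 j.
Proof.
rewrite /cons_rV mxE; case: splitP => [i|k [jk]]; first by rewrite ord1.
by congr (p.2 0 _); apply: val_inj.
Qed.

Lemma continuous_cons_rV n : continuous (@cons_rV n).
Proof.
move=> p A /nbhs_ballP[e /= e0 eA]; apply/nbhs_ballP; exists e => //= q pq.
apply: eA; split=> // i j; rewrite ord1; have [p1 p2] := pq.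
case: (unliftP ord0 j) => [k|] ->; rewrite ?cons_rVS ?cons_rV0//.
by case: p2.
Qed.

(* An open set of R * R^n is a countable union of rectangles ]a, b[ * V with
   a, b rational and V open. *)
Lemma measurable_cons_rV n : measurable_fun [set: measurableTypeR R * 'rV[R]_n] (@cons_rV n).
Proof.
apply: (measurability (@open 'rV[R]_n.+1)) => // _ [B oB <-].
rewrite setTI; set P := _ @^-1` B.
have oP : open P by apply: open_comp => // x _; exact: continuous_cons_rV.
pose I (q : rat * rat) : set R := `]ratr q.1, ratr q.2[%classic.
pose V q : set 'rV[R]_n := [set v | forall x, I q x -> P (x, v)]°.
have mIV q : measurable (I q `*` V q).
  by apply: measurableX; [exact: measurable_itv|
                          apply: open_measurable_mx; exact: open_interior].
rewrite (_ : P = \bigcup_q (I q `*` V q)).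
  by apply: countable_bigcupT_measurable.
apply/seteqP; split => [[x v] Pxv|[x v] [q _ [/= Ix /interior_subset]]]; last first.
  exact.
have /nbhs_ballP[e /= e0 eP] : nbhs (x, v) P by exact: open_nbhs_nbhs.
have /rat_in_itvoo[a] : x - e < x by rewrite ltrBlDr ltrDl.
rewrite in_itv/= => /andP[xa ax].
have /rat_in_itvoo[b] : x < x + e by rewrite ltrDl.
rewrite in_itv/= => /andP[xb bx].
exists (a, b) => //; split; first by rewrite /I /= in_itv/= ax xb.
rewrite /V /interior /=; apply/nbhs_ballP; exists e => //= u [_ vu] y.
rewrite /I /= in_itv/= => /andP[ay yb]; apply: eP; split => //=.
rewrite /ball/= ltr_distlC; apply/andP; split.
  exact: lt_trans xa ay.
exact: lt_trans yb bx.
Qed.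

Section lebesgue_step.
Variables (n : nat) (mu : {sigma_finite_measure set 'rV[R]_n -> \bar R}).

Let nu : {measure set (measurableTypeR R * 'rV[R]_n)%type -> \bar R} := (@lebesgue_measure R \x mu)%E.

Definition lebesgue_step : set 'rV[R]_n.+1 -> \bar R :=
  pushforward nu (@cons_rV n).

Let mC (A : set 'rV[R]_n.+1) : measurable A -> measurable (@cons_rV n @^-1` A).
Proof. by move=> mA; rewrite -[X in measurable X]setTI; exact: measurable_cons_rV. Qed.

Let step0 : lebesgue_step set0 = 0%E.
Proof. by rewrite /lebesgue_step /pushforward preimage_set0 measure0. Qed.

Let step_ge0 A : (0 <= lebesgue_step A)%E.
Proof. by rewrite /lebesgue_step /pushforward; exact: measure_ge0. Qed.

Let step_sigma_additive : semi_sigma_additive lebesgue_step.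
Proof.
move=> F mF tF mUF; rewrite /lebesgue_step /pushforward preimage_bigcup.
apply: measure_semi_sigma_additive.
- by move=> k; exact: mC.
- apply/trivIsetP => /= i j _ _ ij; rewrite -preimage_setI.
  by move/trivIsetP : tF => /(_ _ _ _ _ ij) ->//; rewrite preimage_set0.
- by rewrite -preimage_bigcup; exact: mC.
Qed.

HB.instance Definition _ := isMeasure.Build _ _ _ lebesgue_step
  step0 step_ge0 step_sigma_additive.


Let tail_rV (v : 'rV[R]_n.+1) : 'rV[R]_n := \row_j v 0 (lift ord0 j).

Let measurable_tail : measurable_fun setT tail_rV.
Proof.
apply: continuous_measurable_mx => v A /nbhs_ballP[e /= e0 eA].
apply/nbhs_ballP; exists e => //= u [_ vu]; apply: eA; split=> // i j.
by rewrite !mxE; exact: vu.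
Qed.

Let measurable_head : measurable_fun setT (fun v : 'rV[R]_n.+1 => v 0 ord0 : measurableTypeR R).
Proof.
apply: (measurability _ (measurable_realfun.RGenOpens.measurableE R)) => _ [_ [a [b ->] <-]].
rewrite setTI; apply: open_measurable_mx; apply: open_comp.
  by move=> v _; exact: coord_continuous.
exact: interval_open.
Qed.

Let cons_rVK : cancel (@cons_rV n) (fun v => (v 0 ord0, tail_rV v)).
Proof.
move=> [x v]; rewrite cons_rV0; congr pair; apply/rowP => j.
by rewrite mxE cons_rVS.
Qed.

Let step_sigma_finite : sigma_finite setT lebesgue_step.
Proof.
have /sigma_finiteP[F [FT ndF Foo]] := sigma_finiteT (@lebesgue_measure R).
have /sigma_finiteP[G [GT ndG Goo]] := sigma_finiteT mu.
pose un (v : 'rV[R]_n.+1) : measurableTypeR R * 'rV[R]_n := (v 0 ord0, tail_rV v).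
have mun : measurable_fun setT un by exact: measurable_fun_pair.
exists (fun k => un @^-1` (F k `*` G k)) => [|k].
  rewrite -preimage_bigcup; apply/esym/seteqP; split=> // v _.
  have [i _ Fi] : (\bigcup_i F i) (v 0 ord0) by rewrite -FT.
  have [j _ Gj] : (\bigcup_i G i) (tail_rV v) by rewrite -GT.
  exists (maxn i j) => //; split => /=.
  - by move: Fi; exact/subsetPset/ndF/leq_maxl.
  - by move: Gj; exact/subsetPset/ndG/leq_maxr.
have [mF Fk] := Foo k; have [mG Gk] := Goo k.
have mFG : measurable (F k `*` G k) by exact: measurableX.
split; first by rewrite -[X in measurable X]setTI; exact: mun.
rewrite /lebesgue_step /pushforward -comp_preimage.
rewrite (_ : un \o _ = idfun); last by apply/funext => p; exact: cons_rVK.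
by rewrite preimage_id /nu /= product_measure1E// lte_mul_pinfty// ge0_fin_numE.
Qed.

HB.instance Definition _ := Measure_isSigmaFinite.Build _ _ _ lebesgue_step
  step_sigma_finite.

End lebesgue_step.

Definition dirac_rV0 : set 'rV[R]_0 -> \bar R := \d_(0 : 'rV[R]_0).

HB.instance Definition _ := Measure.on dirac_rV0.

Let dirac_rV0_fin : fin_num_fun dirac_rV0.
Proof. by move=> A mA; rewrite /dirac_rV0 diracE. Qed.

HB.instance Definition _ := Measure_isFinite.Build _ _ _ dirac_rV0 dirac_rV0_fin.

(* Lebesgue measure on R^n; it is defined by recursion, R^n.+1 being identified
   with R * R^n. *)
Fixpoint lebesgue_rV n : {sigma_finite_measure set 'rV[R]_n -> \bar R} :=
  match n return {sigma_finite_measure set 'rV[R]_n -> \bar R} with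
  | 0%N => dirac_rV0
  | k.+1 => lebesgue_step (lebesgue_rV k)
  end.

End lebesgue_rV.

Section euclidean.
Variables (R : realType) (n : nat).
Implicit Types (x y : 'rV[R]_n) (A : set 'rV[R]_n).

(* The library norm `|x| on row vectors is the maximum norm; lengths, diameters
   and balls here are Euclidean. Both norms define the same topology. *)
Definition enorm x : R := Num.sqrt (\sum_i x 0 i ^+ 2).

Definition eball x (r : R) : set 'rV[R]_n := [set y | enorm (y - x) < r].

Definition diam A : R := sup [set enorm (x - y) | x in A & y in A].

Definition inradius A : R :=
  sup [set r | 0 <= r /\ exists c, eball c r `<=` A].

Definition frontier A : set 'rV[R]_n := closure A `\` A°.

End euclidean.

Section simplices.
Variables (R : realType) (n : nat).

(* A family of k points of R^n is given by the rows of a matrix. *)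
Definition affinely_independent k (V : 'M[R]_(k, n)) : Prop :=
  forall c : 'rV[R]_k, \sum_i c 0 i = 0 -> c *m V = 0 -> c = 0.

Definition conv_hull k (V : 'M[R]_(k, n)) : set 'rV[R]_n :=
  [set c *m V | c in [set c : 'rV[R]_k |
    (forall i, 0 <= c 0 i) /\ \sum_i c 0 i = 1]].

Definition barycenter k (V : 'M[R]_(k, n)) : 'rV[R]_n :=
  k%:R^-1 *: \sum_i row i V.

(* Bounded domain whose boundary is a finite union of (n-1)-simplices: of
   points if n = 1, of segments if n = 2, of triangles if n = 3. For n = 1 these
   are the bounded open intervals. *)
Definition polyhedral_domain (D : set 'rV[R]_n) : Prop :=
  [/\ D !=set0, open D, connected D, bounded_set D &
      exists (N : nat) (F : 'I_N -> 'M[R]_(n, n)),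
        (forall i, affinely_independent (F i)) /\
        frontier D = \bigcup_i conv_hull (F i)].

End simplices.

Section sides.
Variables (R : realType) (d : nat).

(* A (d-1)-dimensional flat side in R^d: the image of the closure of a polyhedral
   domain of R^(d-1) by the isometry u |-> origin + u *m frame. It is a line
   segment if d = 2 and a plane polygon if d = 3. *)
Record side := Side {
  origin : 'rV[R]_d;
  frame : 'M[R]_(d.-1, d);
  shape : set 'rV[R]_d.-1;
  frame_orthonormal : frame *m frame^T = 1%:M;
  shape_polyhedral : polyhedral_domain shape
}.

Definition chart (s : side) (u : 'rV[R]_d.-1) : 'rV[R]_d :=
  origin s + u *m frame s.

Definition side_set (s : side) : set 'rV[R]_d :=
  chart s @` closure (shape s).

Definition side_relint (s : side) : set 'rV[R]_d :=
  chart s @` (closure (shape s))°.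

Lemma continuous_chart s : continuous (chart s).
Proof.
move=> u A [P nP PA].
apply: (@filterS _ (nbhs u) _
    [set v | forall i j, P i j (chart s v i j)]) => [v|]; first exact: PA.
apply: (@filter_forall _ _ _ (nbhs u)) => i.
apply: (@filter_forall _ _ _ (nbhs u)) => j.
suff cf : continuous (fun u : 'rV[R]_d.-1 => chart s u i j) by exact: cf (nP i j).
rewrite (_ : (fun _ => _) =
    fun u : 'rV_d.-1 => origin s i j + \sum_k u i k * frame s k j); last first.
  by apply/funext => v; rewrite !mxE.
move=> v; apply: (@cvgD _ _ _ (nbhs v) (nbhs_filter v)).
  exact: (@cvg_cst _ _ _ (nbhs v) (nbhs_filter v)).
apply: (@cvg_big _ _ _ _ _ _ _ (nbhs v) _ _ _ (nbhs_filter v)) => [|k _].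
  exact: add_continuous.
apply: (@cvgM _ _ (nbhs v) (nbhs_filter v)).
  exact: coord_continuous.
exact: (@cvg_cst _ _ _ (nbhs v) (nbhs_filter v)).
Qed.

Variables (J : nat) (Gam : 'I_J -> side).

Definition sides_union : set 'rV[R]_d := \bigcup_j side_set (Gam j).

(* Surface measure of a union of flat sides overlapping only in null sets: each
   side is measured by (d-1)-dimensional Lebesgue measure in its isometric
   chart. *)
Definition surface_measure (A : set 'rV[R]_d) : \bar R :=
  (\sum_(j < J)
     lebesgue_rV R d.-1 (closure (shape (Gam j)) `&` chart (Gam j) @^-1` A))%E.

Let mchart j (A : set 'rV[R]_d) : measurable A ->
  measurable (closure (shape (Gam j)) `&` chart (Gam j) @^-1` A).
Proof.
move=> mA; apply: measurableI.
  by apply: closed_measurable_mx; exact: closed_closure.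
rewrite -[X in measurable X]setTI.
by apply: continuous_measurable_mx => //; exact: continuous_chart.
Qed.

Let surface0 : surface_measure set0 = 0%E.
Proof.
by rewrite /surface_measure big1// => j _; rewrite preimage_set0 setI0 measure0.
Qed.

Let surface_ge0 A : (0 <= surface_measure A)%E.
Proof. by rewrite /surface_measure; exact: sume_ge0. Qed.

Let surface_sigma_additive : semi_sigma_additive surface_measure.
Proof.
move=> F mF tF mUF; rewrite [X in _ --> X](_ : _ =
    lim ((fun n => \sum_(0 <= i < n) surface_measure (F i))%E @ \oo)).
  by apply: is_cvg_ereal_nneg_natsum => k _; exact: surface_ge0.
rewrite nneseries_sum//; apply: eq_bigr => /= j _.
rewrite preimage_bigcup setI_bigcupr; apply: measure_semi_bigcup.
- by move=> i; exact: mchart.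
- apply/trivIsetP => /= i k _ _ ik; rewrite setIACA -preimage_setI.
  by move/trivIsetP : tF => /(_ _ _ _ _ ik) ->//; rewrite preimage_set0 setI0.
- by rewrite -setI_bigcupr -preimage_bigcup; exact: mchart.
Qed.

HB.instance Definition _ := isMeasure.Build _ _ _ surface_measure
  surface0 surface_ge0 surface_sigma_additive.

End sides.

(* The L^p(A) norm is the L^p norm of the extension by zero outside A. *)
Definition Lnorm_on (R : realType) dT (T : measurableType dT)
    (mu : {measure set T -> \bar R}) (p : \bar R) (A : set T) (w : T -> R)
    : \bar R :=
  'N[mu]_p[EFin \o patch (fun=> 0) A w].

Section interface.
Variables (R : realType) (d : nat).
Implicit Types (Omega Gamma : set 'rV[R]_d).

Record is_interface Omega (Omega_ : 'I_2 -> set 'rV[R]_d) Gamma : Prop := {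
  interface_compact : compact (closure Gamma);
  interface_sub : closure Gamma `<=` Omega;
  subdomains_neq0 : forall i, Omega_ i !=set0;
  subdomains_open : forall i, open (Omega_ i);
  subdomains_disjoint : Omega_ 0 `&` Omega_ 1 = set0;
  subdomains_closure :
    closure (Omega_ 0) `|` closure (Omega_ 1) = closure Omega;
  interface_separates : Omega `\` Gamma = Omega_ 0 `|` Omega_ 1;
  interface_frontier : Gamma = frontier (Omega_ 0) `&` frontier (Omega_ 1)
}.

Record is_polyhedral_interface Omega (Omega_ : 'I_2 -> set 'rV[R]_d)
    J (Gam : 'I_J -> side R d) : Prop := {
  polyhedral_is_interface : is_interface Omega Omega_ (sides_union Gam);
  sides_nonoverlapping : trivIset setT (fun j => side_relint (Gam j))
}.

End interface.

Section mesh.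
Variables (R : realType) (d : nat).
Implicit Types (Omega Gamma : set 'rV[R]_d).

(* Mesh elements are open simplices, given by their d+1 vertices. *)
Definition element (V : 'M[R]_(d.+1, d)) : set 'rV[R]_d := (conv_hull V)°.

Definition is_cut Gamma (V : 'M[R]_(d.+1, d)) : Prop :=
  element V `&` Gamma !=set0.

Definition element_diam (V : 'M[R]_(d.+1, d)) : R := diam (element V).

Record is_simplicial_partition Omega N (T : 'I_N -> 'M[R]_(d.+1, d)) : Prop := {
  element_nondegenerate : forall k, affinely_independent (T k);
  element_sub : forall k, element (T k) `<=` Omega;
  element_disjoint : trivIset setT (fun k => element (T k));
  element_cover : closure Omega = \bigcup_k closure (element (T k))
}.

(* The index set is finite and, for a partition of a nonempty set, nonempty, so
   sup and inf below are a maximum and a minimum. *)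
Definition mesh_size N (T : 'I_N -> 'M[R]_(d.+1, d)) : R :=
  sup (range (fun k => element_diam (T k))).

Definition mesh_inradius N (T : 'I_N -> 'M[R]_(d.+1, d)) : R :=
  inf (range (fun k => inradius (element (T k)))).

Record is_admissible_mesh (Cnu : R) Omega
    (Omega_ : 'I_2 -> set 'rV[R]_d) Gamma
    N (T : 'I_N -> 'M[R]_(d.+1, d)) : Prop := {
  mesh_partition : is_simplicial_partition Omega T;
  mesh_quasi_uniform : mesh_size T <= Cnu * mesh_inradius T;
  cut_away_from_boundary : forall k, is_cut Gamma (T k) ->
    closure (element (T k)) `&` frontier Omega = set0;
  cut_neighbors : forall k, is_cut Gamma (T k) -> forall i, exists k',
    element (T k') `<=` Omega_ i /\
    closure (element (T k')) `&` closure (element (T k)) !=set0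
}.

Definition barycentric_ball (V : 'M[R]_(d.+1, d)) : set 'rV[R]_d :=
  eball (barycenter V) (element_diam V).

Definition cut_part Gamma (V : 'M[R]_(d.+1, d)) : set 'rV[R]_d :=
  element V `&` Gamma.

(* Only the sides that intersect the element contribute. *)
Definition ball_part J (Gam : 'I_J -> side R d) (V : 'M[R]_(d.+1, d))
    : set 'rV[R]_d :=
  \bigcup_(j in [set j | side_set (Gam j) `&` element V !=set0])
    (side_set (Gam j) `&` barycentric_ball V).

End mesh.

(* P_m(D): the functions that agree on D with a polynomial of total degree at
   most m. *)
Definition poly_le (R : realType) (d m : nat) (D : set 'rV[R]_d)
    : set ('rV[R]_d -> R) :=
  [set w | exists p : mpoly.mpoly d R, MPoly.degree_le m p /\
           forall x, D x -> w x = mpoly.meval (fun i => x 0 i) p].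

(* Main.v *)
Require Import Defs.
From mathcomp Require Import all_boot all_order all_algebra.
From mathcomp Require mpoly.
From mathcomp Require Import ring lra.

Set Implicit Arguments.
Unset Strict Implicit.
Unset Printing Implicit Defensive.

Import Order.TTheory GRing.Theory Num.Theory.

Local Open Scope ring_scope.

(** The cut part of an element [K] lies on finitely many flat sides, so it is
    enough to bound [|w x|] for one point [x = chart u] of one side [s] by the
    [L^2] norm of [w] on a part of [s] inside the ball [B] of radius [h_K]
    around the barycenter.  Three facts do this.

    Room around [x].  A point of a [d]-simplex is within [d / (d + 1) * h_K] of
    the barycenter ([enorm_barycenter]).  Hence the ball of radius
    [h_K / (d + 1)] around [x] is inside [B], however [x] is placed in [K].

    A fat piece of the side.  The side may have sharp or reentrant corners, and
    [u] may lie on its boundary.  The boundary of its polyhedral shape [D] lies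
    on finitely many hyperplanes, and these cut [D] into finitely many convex
    cells.  Each cell contains a ball of a fixed radius [rho]; contracting this
    ball towards a point of the cell close to [u] gives, for every [r <= 1], a
    ball of radius [c * r] inside [D] and within [r] of [u] ([corkscrew]).  The
    constant [c] depends on [D] only.

    Polynomials.  By Lagrange interpolation, a polynomial of degree at most [m]
    in one variable that is large at [t] stays comparably large on at least one
    of [m + 1] fixed, separated subintervals of any interval of length
    comparable to its distance from [t] ([remez_interval]).  Induction on the
    dimension, one coordinate at a time, turns this into a lower bound for the
    measure of the part of a cube on which a polynomial in several variables is
    comparable to its value at a nearby point ([remez_cube]).

    Applied to [w] on the fat piece, the last fact says that
    [|w| >= kappa ^ (d - 1) * |w x|] on a part of the side inside [B] whose
    measure is at least a constant times [h_K ^ (d - 1)].  Chebyshev's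
    inequality for [|w| ^ 2] ([Lnorm_on2_ge]) then gives the estimate.  The only
    restriction on the mesh size is [h < 1], which keeps the radius [r] in the
    range of the corkscrew property. *)

(** * Polynomials along lines *)

Lemma size_prod_exp_affine (R : idomainType) (I : Type) (r : seq I)
    (p : I -> {poly R}) (a : I -> nat) :
  (forall i, (size (p i) <= 2)%N) ->
  (size (\prod_(i <- r) p i ^+ a i)%R <= (\sum_(i <- r) a i).+1)%N.
Proof.
move=> p2; elim: r => [|i r IH]; first by rewrite !big_nil size_poly1.
rewrite !big_cons; apply: leq_trans (size_polyMleq _ _) _.
have pi : (size (p i ^+ a i) <= (a i).+1)%N.
  apply: leq_trans (size_poly_exp_leq _ _) _; rewrite ltnS.
  by have := p2 i; case: (size _) => [|[|[|]]]//= _; rewrite ?mul0n ?mul1n.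
by rewrite -subn1 leq_subLR add1n -addSn -addnS; apply: leq_add.
Qed.

(* The structures on multi-indices are found only where mpoly is imported, and
   its notations cannot be in scope together with those used afterwards. *)
Module MPolyLines.
Import mpoly.

(** Each factor of a monomial restricts to a polynomial of size at most 2 in the
    parameter of the line, so that the degree of the restriction is bounded by
    the total degree. *)
Lemma meval_line (R : idomainType) (d : nat) (p : {mpoly R[d]}) (x e : 'I_d -> R) :
  exists2 q : {poly R}, (size q <= msize p)%N &
    forall t, meval (fun i => x i + t * e i) p = q.[t].
Proof.
exists (\sum_(a <- msupp p) (p@_a)%:P *
    \prod_i ((x i)%:P + (e i)%:P * 'X) ^+ a i) => [|t].
  apply: (leq_trans (size_sum _ _ _)); apply/bigmax_leqP_seq => a ap _.
  rewrite mul_polyC; apply: leq_trans (size_scale_leq _ _) _.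
  apply: leq_trans (size_prod_exp_affine _ _ _) _ => [i|].
    apply: leq_trans (size_polyD _ _) _; rewrite geq_max.
    rewrite (leq_trans (size_polyC_leq1 _))//=.
    by rewrite mul_polyC (leq_trans (size_scale_leq _ _))// size_polyX.
  by rewrite -mdegE; exact: msize_mdeg_lt.
rewrite mevalE horner_sum; apply: eq_bigr => a _.
rewrite hornerM hornerC horner_prod; congr (_ * _); apply: eq_bigr => i _.
by rewrite horner_exp !hornerE [t * _]mulrC.
Qed.

End MPolyLines.

From mathcomp Require Import all_classical all_reals all_analysis.
From mathcomp Require Import measurable_realfun ess_sup_inf.

Import numFieldTopology.Exports numFieldNormedType.Exports.

Local Open Scope classical_set_scope.
Local Open Scope ring_scope.

(** * A Remez inequality *)

(** In Lagrange's formula, each of the [m] factors of a basis polynomial at [t]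
    is a quotient [(t - x j) / (x i - x j)], at most [L / delta]. *)
Lemma lagrange_bound (R : realType) (m : nat) (x : nat -> R) (q : {poly R})
    (t L delta : R) :
  injective x -> 0 < delta -> (size q <= m.+1)%N ->
  (forall i j, (i <= m)%N -> (j <= m)%N -> i != j -> delta <= `|x i - x j|) ->
  (forall i, (i <= m)%N -> `|t - x i| <= L) ->
  `|q.[t]| <= \sum_(i < m.+1) `|q.[x i]| * (L / delta) ^+ m.
Proof.
move=> xinj d0 sq xd tL.
rewrite {1}(lagrange_gen (ltn0Sn m) xinj sq) horner_sum.
apply: le_trans (ler_norm_sum _ _ _) _; apply: ler_sum => i _.
rewrite hornerM hornerC normrM ler_wpM2l// (lagrangeE (ltn0Sn m) xinj) /=.
rewrite hornerM hornerC !horner_prod -prodfV -big_split/= normr_prod.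
rewrite [leRHS](_ : _ = \prod_(j < m.+1 | j != i) (L / delta)); last first.
  by rewrite prodr_const cardC1 card_ord.
apply: ler_prod => j ji; rewrite normr_ge0/=.
have ij : (i : nat) != j by rewrite eq_sym.
rewrite !hornerXsubC normrM mulrC normfV; apply: ler_pM => //.
- by apply: tL; rewrite -ltnS.
- rewrite lef_pV2 ?posrE//; first by apply: xd => //; rewrite -ltnS.
  by apply: lt_le_trans d0 _; apply: xd => //; rewrite -ltnS.
Qed.

(** The pieces of even index in the subdivision of [[a, a + s]] into [2m + 2]
    equal pieces: skipping every other piece keeps points of distinct slots
    apart. *)
Definition slot (R : realType) (m i : nat) (a s : R) : set R :=
  `[a + s * ((2 * i)%:R / (2 * m).+2%:R),
    a + s * ((2 * i).+1%:R / (2 * m).+2%:R)]%classic.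

Lemma slot_gap (R : realType) (m i j : nat) (a s y z : R) :
  0 <= s -> (i < j)%N -> slot m i a s y -> slot m j a s z ->
  s / (2 * m).+2%:R <= z - y.
Proof.
move=> s0 ij; rewrite /slot /= !in_itv/= => /andP[_ yi] /andP[zj _].
have sM : 0 <= s / (2 * m).+2%:R by rewrite divr_ge0.
have : s / (2 * m).+2%:R * (2 * i).+2%:R <= s / (2 * m).+2%:R * (2 * j)%:R.
  by rewrite ler_wpM2l// ler_nat -[(2 * i).+2]addn2 -mulnSr leq_mul2l.
rewrite -[(2 * i).+2]addn1 natrD mulrDr mulr1.
move: yi zj; rewrite ![s * (_ / _)]mulrA ![s * _ / _]mulrAC.
rewrite lerBrDl => yi zj ij'; apply: le_trans zj.
by apply: le_trans (lerD yi (lexx _)) _; rewrite -addrA lerD2l.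
Qed.

Lemma slot_dist_lt (R : realType) (m i : nat) (a s y : R) :
  0 < s -> (i <= m)%N -> slot m i a s y -> `|a - y| < s.
Proof.
move=> s0 im; rewrite /slot /= in_itv/= => /andP[y0 y1].
have ys : y < a + s.
  apply: le_lt_trans y1 _; rewrite ltrD2l -[X in _ < X]mulr1 ltr_pM2l//.
  by rewrite ltr_pdivrMr// mul1r ltr_nat ltnS ltnS leq_mul2l.
have ay : a <= y.
  apply: le_trans y0; rewrite lerDl.
  by apply: mulr_ge0; [exact: ltW|exact: divr_ge0].
by rewrite distrC ger0_norm ?subr_ge0// ltrBlDl.
Qed.

(** Otherwise every slot would contain a point at which [q] is small, and
    interpolating [q] at these [m + 1] separated points would make [q.[t]]
    smaller than itself. *)
Lemma remez_interval (R : realType) (m : nat) (A : R) : 0 < A ->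
  exists2 kappa : R, 0 < kappa & forall (q : {poly R}) (a s t : R),
    (size q <= m.+1)%N -> 0 < s -> `|t - a| <= A * s ->
    exists2 i, (i <= m)%N &
      forall y, slot m i a s y -> kappa * `|q.[t]| <= `|q.[y]|.
Proof.
move=> A0; set M : R := (2 * m).+2%:R; have M0 : 0 < M by [].
have A1 : 0 < A + 1 by rewrite addr_gt0.
pose L := (((A + 1) * M) ^+ m) *+ m.+1.
have L0 : 0 < L by rewrite pmulrn_lgt0// exprn_gt0// mulr_gt0.
(* Any constant below [L^-1] works; the factor 1/2 makes the contradiction strict. *)
exists (L^-1 / 2) => [|q a s t sq s0 tA]; first by rewrite divr_gt0// invr_gt0.
have kL : L^-1 / 2 < L^-1 by rewrite gtr_pMr ?invr_gt0// invf_lt1// ltr1n.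
apply: contrapT => H.
(* The Lagrange basis is indexed by an injective sequence on all of [nat], hence
   the left endpoints of the slots as nodes beyond [m]. *)
have H1 i : exists y, slot m i a s y /\
    ((i <= m)%N -> `|q.[y]| < L^-1 / 2 * `|q.[t]|).
  have [im|im] := leqP i m; last first.
    exists (a + s * ((2 * i)%:R / M)); split => //.
    rewrite /slot/= in_itv/= lexx lerD2l ler_pM2l//.
    by rewrite ler_pM2r ?invr_gt0// ler_nat leqnSn.
  have : ~ forall y, slot m i a s y -> L^-1 / 2 * `|q.[t]| <= `|q.[y]|.
    by move=> H1; apply: H; exists i.
  move=> /existsNP[y /not_implyP[yi /negP]]; rewrite -ltNge => yq.
  by exists y.
have [x xP] := choice H1.
have gap i j : (i < j)%N -> s / M <= x j - x i.
  by move=> ij; exact: slot_gap (ltW s0) ij (xP i).1 (xP j).1.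
have sM : 0 < s / M by rewrite divr_gt0.
have gap2 i j : i != j -> s / M <= `|x i - x j|.
  rewrite neq_ltn => /orP[] ij; last exact: le_trans (gap _ _ ij) (ler_norm _).
  by rewrite distrC; exact: le_trans (gap _ _ ij) (ler_norm _).
have xinj : injective x.
  move=> i j xij; apply/eqP; apply: contraT => /gap2.
  by rewrite xij subrr normr0 leNgt sM.
have := @lagrange_bound R m x q t ((A + 1) * s) (s / M) xinj sM sq
  (fun i j _ _ => @gap2 i j).
have tx i : (i <= m)%N -> `|t - x i| <= (A + 1) * s.
  move=> im; rewrite mulrDl mul1r.
  apply: le_trans (ler_distD a _ _) _; apply: lerD => //.
  exact/ltW/(slot_dist_lt s0 im (xP i).1).
move=> /(_ tx); rewrite (_ : _ / _ = (A + 1) * M); last first.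
  by rewrite invf_div mulrA [(A + 1) * s * M]mulrAC mulfK ?gt_eqF.
apply/negP; rewrite -ltNge.
have [q0|q0] := eqVneq q.[t] 0.
  have := (xP 0%N).2 isT; rewrite q0 normr0 mulr0.
  by move/(le_lt_trans (normr_ge0 _)); rewrite ltxx.
have qt0 : 0 < `|q.[t]| by rewrite normr_gt0.
apply: (@le_lt_trans _ _
  (\sum_(i < m.+1) L^-1 / 2 * `|q.[t]| * ((A + 1) * M) ^+ m)).
  apply: ler_sum => i _; rewrite ler_wpM2r ?exprn_ge0 ?mulr_ge0 ?ltW//.
  by apply: (xP i).2; rewrite -ltnS.
rewrite sumr_const card_ord -mulrnAr -/L mulrAC -[X in _ < X]mul1r ltr_pM2r//.
by rewrite mulrAC mulVf ?gt_eqF// mul1r invf_lt1// ltr1n.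
Qed.

(** Polynomial of degree at most [m] along every line.  This is the only trace of
    the polynomial structure that the induction on the dimension needs; it is
    stable under affine changes of variables and passes to coordinate slices
    without any manipulation of monomials. *)
Definition line_poly (R : realType) (m n : nat) (f : 'rV[R]_n -> R) : Prop :=
  forall x e : 'rV[R]_n, exists2 q : {poly R}, (size q <= m.+1)%N &
    forall t, f (x + t *: e) = q.[t].

Lemma cons_rVD (R : realType) (n : nat) (x y t : R) (u v : 'rV[R]_n) :
  cons_rV (x + t * y, u + t *: v) = cons_rV (x, u) + t *: cons_rV (y, v).
Proof.
apply/rowP => j; rewrite [RHS]mxE [X in _ = _ + X]mxE.
by case: (unliftP ord0 j) => [k|] ->; rewrite ?cons_rVS ?cons_rV0 ?mxE.
Qed.

Lemma cons_rV_eta (R : realType) (n : nat) (u : 'rV[R]_n.+1) :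
  u = cons_rV (u 0 ord0, \row_j u 0 (lift ord0 j)).
Proof.
apply/rowP => j; case: (unliftP ord0 j) => [k|] ->; last by rewrite cons_rV0.
by rewrite cons_rVS mxE.
Qed.

Lemma line_poly_cons (R : realType) (m n : nat) (f : 'rV[R]_n.+1 -> R) (x : R) :
  line_poly m f -> line_poly m (fun v => f (cons_rV (x, v))).
Proof.
move=> fP v e; have [q sq qE] := fP (cons_rV (x, v)) (cons_rV (0, e)).
by exists q => // t; rewrite -qE -cons_rVD mulr0 addr0.
Qed.

Lemma measurable_fun_cons (R : realType) (n : nat) (f : 'rV[R]_n.+1 -> R)
    (x : R) :
  measurable_fun setT f -> measurable_fun setT (fun v => f (cons_rV (x, v))).
Proof.
move=> mf; apply: (measurableT_comp mf).
apply: (measurableT_comp (@measurable_cons_rV R n)).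
exact: (@measurable_pair1 _ _ (measurableTypeR R)).
Qed.

Lemma measurable_ball_superlevel (R : realType) (n : nat) (f : 'rV[R]_n -> R)
    (v : 'rV[R]_n) (s c : R) :
  measurable_fun setT f -> measurable [set y | ball v s y /\ c <= `|f y|].
Proof.
move=> mf; apply: measurableI.
  by apply: open_measurable_mx; exact: ball_open.
rewrite -[X in measurable X]setTI; apply: measurable_fun_le => //.
exact: measurableT_comp.
Qed.

(** Along the first coordinate, [f] stays comparable to [f u] on one slot.  For
    each point of this slot, the induction hypothesis applies to the slice of [f]
    through it, and the measures of the slices are integrated over the slot. *)
Lemma remez_cube (R : realType) (m : nat) (A : R) : 0 < A ->
  exists kappa eps : R, [/\ 0 < kappa, 0 < eps &
  forall n (f : 'rV[R]_n -> R) (v u : 'rV[R]_n) (s : R),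
    measurable_fun setT f -> line_poly m f -> 0 < s ->
    (forall i, `|u 0 i - v 0 i| <= A * s) ->
    (((eps * s) ^+ n)%:E <=
      lebesgue_rV R n [set y | ball v s y /\ (kappa ^+ n * `|f u| <= `|f y|)%R])%E].
Proof.
move=> A0; have [kappa k0 H1] := remez_interval m A0.
exists kappa, (2 * m).+2%:R^-1; split => //.
elim=> [|n IH] f v u s mf fP s0 uv.
  rewrite /= /dirac_rV0 diracE mem_set//= expr0 mul1r.
  split; last by rewrite [u](_ : _ = 0)//; apply/rowP => -[].
  by split=> // i [].
pose u' : 'rV[R]_n := \row_j u 0 (lift ord0 j).
pose v' : 'rV[R]_n := \row_j v 0 (lift ord0 j).
have [q sq qE] := fP (cons_rV (0, u')) (cons_rV (1, 0)).
have [i im iP] := H1 q (v 0 ord0) s (u 0 ord0) sq s0 (uv ord0).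
have fq x : f (cons_rV (x, u')) = q.[x].
  by rewrite -qE -cons_rVD add0r mulr1 scaler0 addr0.
have fu : f u = q.[u 0 ord0] by rewrite -fq -cons_rV_eta.
set E := [set y | _].
have mE : measurable E by exact: measurable_ball_superlevel.
rewrite /= /lebesgue_step /pushforward /= /product_measure1 /=.
set P := @cons_rV R n @^-1` E.
have mP : measurable (P : set (measurableTypeR R * 'rV[R]_n)).
  by rewrite -[X in measurable X]setTI; exact: measurable_cons_rV.
have mF := measurable_fun_xsection (lebesgue_rV R n) mP.
set F := (X in measurable_fun _ X) in mF *.
pose I : set (measurableTypeR R) := slot m i (v 0 ord0) s.
have mI : measurable I by exact: measurable_itv.
apply: (@le_trans _ _ (\int[lebesgue_measure]_(x in I) F x)%E); last first.
  by apply: ge0_subset_integral.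
apply: (@le_trans _ _ (\int[lebesgue_measure]_(x in I)
   cst (((2 * m).+2%:R^-1 * s) ^+ n)%:E x)%E).
  rewrite integral_cst//.
  rewrite [X in (_ <= _ * X)%E](_ : _ = ((2 * m).+2%:R^-1 * s)%:E); last first.
    apply: etrans (lebesgue_measure_itv _) _.
    rewrite /= lte_fin ltrD2l ltr_pM2l// ltr_pM2r ?invr_gt0// ltr_nat ltnSn.
    rewrite -EFinD opprD addrACA subrr add0r -mulrBr -mulrBl -natrB// subSnn.
    by rewrite mul1r [s * _]mulrC.
  by rewrite -EFinM lee_fin exprSr.
apply: ge0_le_integral => //.
- by move=> x _; rewrite lee_fin exprn_ge0// mulr_ge0// ltW.
- exact: (measurable_funS measurableT (@subsetT _ I) mF).
move=> x xI /=.
apply: le_trans (IH (fun w => f (cons_rV (x, w))) v' u' s _ _ s0 _) _.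
- exact: measurable_fun_cons.
- exact: line_poly_cons.
- by move=> j; rewrite !mxE.
apply: le_measure; rewrite ?inE.
- apply: measurable_ball_superlevel; exact: measurable_fun_cons.
- apply: measurable_xsection; rewrite -[X in measurable X]setTI.
  exact: measurable_cons_rV.
move=> w [[_ bw] fw]; rewrite /xsection /= inE /E /=; split.
  split=> // i' j; rewrite ord1; case: (unliftP ord0 j) => [k|] ->.
    by rewrite cons_rVS; have := bw ord0 k; rewrite mxE.
  rewrite cons_rV0 /=; exact: slot_dist_lt xI.
apply: le_trans fw; rewrite exprSr -mulrA; apply: ler_wpM2l.
  by rewrite exprn_ge0// ltW.
by rewrite fu fq; exact: iP.
Qed.

(** * The corkscrew property of polyhedral domains *)

Lemma continuous_mul_col (R : realType) (n : nat) (a : 'cV[R]_n) :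
  continuous (fun x : 'rV[R]_n => (x *m a) 0 0 : R).
Proof.
move=> x; rewrite (_ : (fun _ => _) = fun u : 'rV_n => \sum_k u 0 k * a k 0);
  last by apply/funext => u; rewrite mxE.
apply: (@cvg_big _ _ _ _ _ _ _ (nbhs x) _ _ _ (nbhs_filter x)) => [|k _].
  exact: add_continuous.
apply: (@cvgM _ _ (nbhs x) (nbhs_filter x)).
  exact: coord_continuous.
exact: (@cvg_cst _ _ _ (nbhs x) (nbhs_filter x)).
Qed.

(** The [k] equations [v *m a = b] on the rows [v] of [V] are linear in the
    [n + 1 > k] unknowns [(a, b)], hence have a nontrivial solution; a solution
    with [a = 0] would have [b = 0] as there is at least one row. *)
Lemma conv_hull_hyperplane (R : realType) (k n : nat) (V : 'M[R]_(k, n)) :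
  (0 < k <= n)%N -> exists2 ab : ('cV[R]_n * R)%type, ab.1 != 0 &
    forall x, conv_hull V x -> (x *m ab.1) 0 0 = ab.2.
Proof.
move=> /andP[k0 kn]; pose A : 'M[R]_(k, n + 1) := row_mx V (const_mx 1).
have : kermx A^T != 0.
  rewrite -mxrank_eq0 mxrank_ker mxrank_tr -lt0n subn_gt0.
  by apply: leq_ltn_trans (rank_leq_row A) _; rewrite addn1 ltnS.
move=> /rowV0Pn[v /sub_kermxP vA v0].
have : A *m v^T = 0 by rewrite -[A]trmxK -trmx_mul vA trmx0.
have [a [b vE]] : exists a b, v^T = col_mx a b :> 'M[R]_(n + 1, 1).
  by exists (usubmx v^T), (dsubmx v^T); rewrite vsubmxK.
rewrite vE mul_row_col => ab.
exists (a, - b 0 0) => /= [|x [c [_ c1] <-]].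
  apply: contra_neq v0 => a0.
  have b0 : b = 0.
    move: ab; rewrite a0 mulmx0 add0r => /matrixP /(_ (Ordinal k0) 0).
    rewrite !mxE big_ord1 !mxE mul1r => b0.
    by apply/matrixP => i j; rewrite !ord1 b0 mxE.
  by rewrite -[v]trmxK vE a0 b0 col_mx0 trmx0.
move/eqP : ab; rewrite addr_eq0 => /eqP ab.
rewrite -mulmxA ab mulmxN mulmxA !mxE big_ord1 !mxE.
congr (- _); rewrite -[RHS]mul1r; congr (_ * _).
rewrite -[RHS]c1; apply: eq_bigr => i _; by rewrite mxE mulr1.
Qed.

(** A point of an open set that lies on a hyperplane can be moved off it along
    the normal. *)
Lemma open_avoid_hyperplanes (R : realType) (n : nat)
    (s : seq ('cV[R]_n * R)) (O : set 'rV[R]_n) :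
  (forall ab, ab \in s -> ab.1 != 0) -> open O -> O !=set0 ->
  exists2 x, O x & forall ab, ab \in s -> (x *m ab.1) 0 0 != ab.2.
Proof.
elim: s O => [|[a b] s IH] O s0 oO O0.
  by have [x Ox] := O0; exists x.
pose H := [set x : 'rV[R]_n | (x *m a) 0 0 != b].
have oH : open H.
  rewrite (_ : H = (fun x => (x *m a) 0 0 : R) @^-1` (~` [set b])); last first.
    by apply/seteqP; split => x /= /eqP.
  apply: open_comp => [x _|]; first exact: continuous_mul_col.
  by apply: closed_openC; exact: closed_eq.
have a0 : a != 0 by have := s0 (a, b); rewrite mem_head; exact.
have [|||x [Ox Hx] xs] := IH (O `&` H).
- by move=> ab abs; apply: s0; rewrite in_cons abs orbT.
- exact: openI.
- have [x Ox] := O0; have [xb|xb] := eqVneq ((x *m a) 0 0) b; last by exists x.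
  have /nbhs_ballP[e /= e0 eO] : nbhs x O by exact: open_nbhs_nbhs.
  pose t : R := e / (`|a^T| + 1).
  have t0 : 0 < t by rewrite divr_gt0// ltr_wpDl.
  exists (x + t *: a^T); split.
    apply: eO; rewrite -ball_normE /= opprD addNKr normrN normrZ gtr0_norm//.
    by rewrite /t -mulrA gtr_pMr// ltr_pdivrMl ?ltr_wpDl// mulr1 ltrDl.
  rewrite /H /= mulmxDl mxE xb -[X in _ != X]addr0 (inj_eq (addrI _)).
  rewrite -scalemxAl mxE; apply: mulf_neq0; first by rewrite gt_eqF.
  apply: contra_neq a0; rewrite mxE => /eqP.
  rewrite psumr_eq0 => [/allP aa|i _]; last by rewrite mxE sqr_ge0.
  apply/colP => i; have := aa i; rewrite mem_index_enum mxE => /(_ isT).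
  by rewrite -expr2 sqrf_eq0 mxE => /eqP.
- exists x => // ab; rewrite in_cons => /orP[/eqP ->//|]; exact: xs.
Qed.

Definition convex_set (R : realType) (n : nat) (C : set 'rV[R]_n) : Prop :=
  forall x y t, C x -> C y -> 0 <= t <= 1 -> C (x + t *: (y - x)).

(** The contraction of centre [p] and ratio [t] maps a convex set containing [p]
    into itself, and maps [ball v rho] onto the ball in the statement. *)
Lemma convex_ball (R : realType) (n : nat) (C : set 'rV[R]_n) (p v : 'rV[R]_n)
    (t rho : R) :
  convex_set C -> C p -> ball v rho `<=` C -> 0 < t <= 1 ->
  ball (p + t *: (v - p)) (t * rho) `<=` C.
Proof.
move=> cC Cp vC /andP[t0 t1] y; rewrite -ball_normE /= => yv.
pose z := v + t^-1 *: (y - (p + t *: (v - p))).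
rewrite (_ : y = p + t *: (z - p)); last first.
  rewrite /z addrAC scalerDr scalerA divff ?gt_eqF// scale1r addrA.
  by rewrite [RHS]addrC subrK.
apply: cC => //; last by rewrite t1 ltW.
apply: vC; rewrite -ball_normE /= /z opprD addNKr normrN normrZ.
by rewrite gtr0_norm ?invr_gt0// ltr_pdivrMl// distrC.
Qed.

(** Along a segment in [C] the sets [D] and [closure D] have the same trace, which
    is therefore both open and closed. *)
Lemma convex_sub_open (R : realType) (n : nat) (C D : set 'rV[R]_n) :
  convex_set C -> open D -> C `&` frontier D = set0 -> C `&` D !=set0 ->
  C `<=` D.
Proof.
move=> cC oD CD [x [Cx Dx]] y Cy.
pose f (t : R) : 'rV[R]_n := x + t *: (y - x).
have cf : continuous f.
  move=> t; apply: cvgD; first exact: cvg_cst.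
  by apply: cvgZr_tmp; exact: cvg_id.
pose S := f @` `[0, 1]%classic.
have cS : connected S.
  apply: connected_continuous_connected; first exact: segment_connected.
  exact: continuous_subspaceT.
have SC : S `<=` C.
  by move=> z [t] /=; rewrite in_itv/= => t01 <-; exact: cC.
have Sx : S x by exists 0; rewrite /= ?in_itv/= ?lexx ?ler01// /f scale0r addr0.
have Sy : S y.
  by exists 1; rewrite /= ?in_itv/= ?lexx ?ler01// /f scale1r addrC subrK.
suff SD : S `&` D = S by move: Sy; rewrite -SD => -[].
apply: cS.
- by exists x.
- by exists D.
- exists (closure D); first exact: closed_closure.
  apply/seteqP; split => z [Sz Dz]; split => //; first exact: subset_closure.
  apply: contrapT => nDz.
  have : (C `&` frontier D) z.
    split; first exact: SC.
    by split=> //; rewrite ((interior_id D).1 oD).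
  by rewrite CD.
Qed.

(** A cell of the arrangement of the hyperplanes [x *m a = b]: the sign vector
    [sigma] selects a side of each. *)
Definition cell (R : realType) (n N : nat) (H : 'I_N -> 'cV[R]_n * R)
    (sigma : {ffun 'I_N -> bool}) : set 'rV[R]_n :=
  [set x | forall i, 0 < (-1) ^+ sigma i * ((x *m (H i).1) 0 0 - (H i).2)].

Lemma convex_cell (R : realType) (n N : nat) (H : 'I_N -> 'cV[R]_n * R)
    (sigma : {ffun 'I_N -> bool}) : convex_set (cell H sigma).
Proof.
move=> x y t Cx Cy /andP[t0 t1] i; have {Cx Cy} := (Cx i, Cy i).
move: (_ ^+ _) => e [Cx Cy].
have -> : ((x + t *: (y - x)) *m (H i).1) 0 0 =
    (x *m (H i).1) 0 0 + t * ((y *m (H i).1) 0 0 - (x *m (H i).1) 0 0).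
  rewrite mulmxDl -scalemxAl mulmxBl [LHS]mxE; congr (_ + _).
  by rewrite [LHS]mxE; congr (_ * _); rewrite [LHS]mxE; congr (_ + _); rewrite mxE.
move: Cx Cy; set a := (x *m _) 0 0; set b := (y *m _) 0 0 => Cx Cy.
rewrite (_ : e * _ = (1 - t) * (e * (a - (H i).2)) + t * (e * (b - (H i).2))); last by ring.
have [->|t0'] := eqVneq t 0; first by rewrite subr0 mul1r mul0r addr0.
apply: ltr_wpDl; first by rewrite mulr_ge0 ?subr_ge0// ltW.
by rewrite mulr_gt0// lt_def t0'.
Qed.

Lemma open_cell (R : realType) (n N : nat) (H : 'I_N -> 'cV[R]_n * R)
    (sigma : {ffun 'I_N -> bool}) : open (cell H sigma).
Proof.
rewrite openE => x Cx; apply: (@filter_forall _ _ _ (nbhs x)) => i.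
pose g (x : 'rV[R]_n) : R := (-1) ^+ sigma i * ((x *m (H i).1) 0 0 - (H i).2).
have cg : g y @[y --> x] --> g x.
  have FF := nbhs_filter x; have cst := @cvg_cst _ _ _ (nbhs x) FF.
  apply: (@cvgM _ _ (nbhs x) FF); first exact: cst.
  apply: (@cvgB _ _ _ (nbhs x) FF); last exact: cst.
  exact: continuous_mul_col.
exact: (@cvgr_gt _ _ (nbhs x) (nbhs_filter x) g _ cg _ (Cx i)).
Qed.

Lemma mem_cell (R : realType) (n N : nat) (H : 'I_N -> 'cV[R]_n * R) x :
  (forall i, (x *m (H i).1) 0 0 != (H i).2) ->
  cell H [ffun i => (x *m (H i).1) 0 0 < (H i).2] x.
Proof.
move=> xH i; rewrite ffunE; have := xH i; rewrite neq_lt => /orP[xi|xi].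
  by rewrite xi expr1 mulN1r opprB subr_gt0.
by rewrite (lt_gtF xi) mul1r subr_gt0.
Qed.

(** The point [p] close to [u] lies in a cell contained in [D], and the inscribed
    ball of this cell is contracted towards [p].  Passing through [p] avoids
    showing that [u] is in the closure of a cell. *)
Lemma corkscrew (R : realType) (n : nat) (D : set 'rV[R]_n) :
  (0 < n)%N -> polyhedral_domain D ->
  \forall c \near (0 : R)^'+, forall u r, closure D u -> 0 < r <= 1 ->
    exists2 v, ball v (c * r) `<=` D & ball v (c * r) `<=` ball u r.
Proof.
move=> n0 [_ oD _ [M0 [_ DM0]] [N [F [_ FD]]]].
suff [c c0 cP] : exists2 c : R, 0 < c & forall u r, closure D u -> 0 < r <= 1 ->
    exists2 v, ball v (c * r) `<=` D & ball v (c * r) `<=` ball u r.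
  near=> c' => u r uD r01; have [v vD vu] := cP u r uD r01.
  have cr : c' * r <= c * r.
    case/andP: r01 => r0 _; rewrite ler_pM2r//.
    by near: c'; exact: nbhs_right_le.
  by exists v; [apply: subset_trans vD|apply: subset_trans vu]; exact: le_ball.
pose M := `|M0| + 1; have M_gt0 : 0 < M by rewrite ltr_wpDl.
have DM x : D x -> `|x| <= M.
  by apply: DM0; rewrite /M ltr_pwDr// ler_norm.
have /choice[H HP] : forall i : 'I_N, exists ab : ('cV[R]_n * R)%type, ab.1 != 0 /\
    forall x, conv_hull (F i) x -> (x *m ab.1) 0 0 = ab.2.
  move=> i; have [|ab ab0 abF] := @conv_hull_hyperplane _ _ _ (F i).
    by rewrite n0 leqnn.
  by exists ab.
have cellD sigma : cell H sigma `&` D !=set0 -> cell H sigma `<=` D.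
  apply: convex_sub_open => //; first exact: convex_cell.
  rewrite FD; apply/seteqP; split => // x [Cx [i _ Fx]].
  by have := Cx i; rewrite ((HP i).2 x Fx) subrr mulr0 ltxx.
(* There are finitely many cells, so one radius serves all of them. *)
have : \forall rho \near (0 : R)^'+, forall sigma : {ffun 'I_N -> bool},
    cell H sigma `&` D !=set0 -> exists v, ball v rho `<=` cell H sigma.
  apply: filter_forall => sigma.
  have [[v [Cv Dv]]|nCD] := pselect (cell H sigma `&` D !=set0); last first.
    by apply: filterE => rho /nCD.
  have /nbhs_ballP[e /= e0 eC] : nbhs v (cell H sigma).
    by apply: open_nbhs_nbhs; split => //; exact: open_cell.
  near=> rho => _; exists v; apply: subset_trans eC; apply: le_ball.
  by near: rho; exact: nbhs_right_le.
move=> rhoP.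
have [rho [rho0 {}rhoP]] : exists rho : R, 0 < rho /\
   forall sigma : {ffun 'I_N -> bool},
    cell H sigma `&` D !=set0 -> exists v, ball v rho `<=` cell H sigma.
  have : \forall rho \near (0 : R)^'+, 0 < rho /\ forall sigma : {ffun 'I_N -> bool},
    cell H sigma `&` D !=set0 -> exists v, ball v rho `<=` cell H sigma.
    by near=> rho; split; near: rho => //; exact: nbhs_right_gt.
  by move/filter_ex.
(* With ratio [t0 * r], the contracted ball is within [r / 2] of [p], as two
   points of [D] are at most [2 * M] apart. *)
have Q0 : 0 < 2 * (2 * M + rho + 1).
  by rewrite mulr_gt0// addr_gt0// addr_gt0// mulr_gt0.
pose t0 := (2 * (2 * M + rho + 1))^-1.
have t00 : 0 < t0 by rewrite invr_gt0.
have t0M : t0 * (2 * M + rho) <= 2^-1.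
  rewrite /t0 mulrC ler_pdivrMr// mulrA mulVf// mul1r lerDl//.
have t01 : t0 <= 1.
  by rewrite invf_le1//; lra.
exists (t0 * rho) => [|u r uD /andP[r0 r1]]; first by rewrite mulr_gt0.
have [p [pD pu] pH] : exists2 p, (D `&` ball u (r / 2)) p & forall ab,
    ab \in [seq H i | i : 'I_N] -> (p *m ab.1) 0 0 != ab.2.
  apply: open_avoid_hyperplanes.
  - by move=> ab /mapP[i _ ->]; exact: (HP i).1.
  - by apply: openI => //; exact: ball_open.
  - apply: uD; apply: nbhsx_ballx; exact: divr_gt0.
have {}pH : cell H [ffun i => (p *m (H i).1) 0 0 < (H i).2] p.
  by apply: mem_cell => i; apply: pH; apply: map_f; rewrite mem_enum.
move: pH; set sigma := finfun _ => pH.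
have CD : cell H sigma `<=` D by apply: cellD; exists p.
have [v0 v0C] : exists v, ball v rho `<=` cell H sigma.
  by apply: rhoP; exists p.
pose t := t0 * r.
have tgt0 : 0 < t by rewrite mulr_gt0.
have tle1 : t <= 1 by rewrite mulr_ile1// ltW.
have Dv0 : D v0 by apply: CD; apply: v0C; exact: ballxx.
exists (p + t *: (v0 - p)).
- rewrite mulrAC -/t; apply: subset_trans CD.
  apply: (convex_ball (@convex_cell _ _ _ H sigma) pH v0C).
  by rewrite tgt0.
- rewrite -ball_normE => y /= yv.
  move: pu; rewrite -ball_normE /= => pu.
  have : `|u - y| <= `|u - p| + t * `|v0 - p| + `|p + t *: (v0 - p) - y|.
    rewrite -[X in X * `|v0 - p|](gtr0_norm tgt0) -normrZ.
    apply: le_trans (ler_distD (p + t *: (v0 - p)) _ _) _; rewrite lerD2r.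
    apply: le_trans (ler_distD p _ _) _; rewrite lerD2l.
    by rewrite opprD addNKr normrN.
  have v0p : `|v0 - p| <= 2 * M.
    rewrite mulr_natl mulr2n.
    by apply: le_trans (ler_normB _ _) _; apply: lerD; exact: DM.
  move/le_lt_trans; apply.
  have tv0p : t * `|v0 - p| <= t * (2 * M) by rewrite ler_pM2l.
  have trho : t * (2 * M) + t * rho <= r / 2.
    by rewrite -mulrDr /t [t0 * r]mulrC -mulrA ler_pM2l.
  rewrite [ltRHS](splitr r) -addrA; apply: ltr_leD pu _.
  apply: le_trans trho; apply: lerD tv0p _.
  by rewrite /t mulrAC ltW.
Unshelve. all: by end_near. Qed.

(** * Euclidean geometry of simplices *)

Section euclidean_norm.
Variables (R : realType) (n : nat).
Implicit Types x y : 'rV[R]_n.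

Lemma enorm_ge0 x : 0 <= enorm x.
Proof. exact: sqrtr_ge0. Qed.

Lemma sqr_enorm x : enorm x ^+ 2 = \sum_i x 0 i ^+ 2.
Proof. by rewrite sqr_sqrtr// sumr_ge0// => i _; exact: sqr_ge0. Qed.

Lemma enorm_eq0 x : enorm x = 0 -> x = 0.
Proof.
move=> x0; have /esym/eqP := sqr_enorm x; rewrite x0 expr0n/=.
rewrite psumr_eq0 => [/allP x0i|i _]; last exact: sqr_ge0.
apply/rowP => i; have := x0i i; rewrite mem_index_enum sqrf_eq0 mxE => /(_ isT).
by move/eqP.
Qed.

Lemma enorm0 : enorm (0 : 'rV[R]_n) = 0.
Proof.
rewrite /enorm big1 ?sqrtr0// => i _.
by rewrite mxE expr0n.
Qed.

Lemma enormZ (t : R) x : enorm (t *: x) = `|t| * enorm x.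
Proof.
rewrite /enorm -sqrtr_sqr -sqrtrM ?sqr_ge0// mulr_sumr; congr Num.sqrt.
by apply: eq_bigr => i _; rewrite mxE exprMn.
Qed.

Lemma enorm_dot x y : \sum_i x 0 i * y 0 i <= enorm x * enorm y.
Proof.
have [/enorm_eq0 ->|x0] := eqVneq (enorm x) 0.
  by rewrite enorm0 mul0r big1// => i _; rewrite mxE mul0r.
have [/enorm_eq0 ->|y0] := eqVneq (enorm y) 0.
  by rewrite enorm0 mulr0 big1// => i _; rewrite mxE mulr0.
have [a0 b0] : 0 < enorm x /\ 0 < enorm y by rewrite !lt_def x0 y0 !enorm_ge0.
have : 0 <= \sum_i (enorm y * x 0 i - enorm x * y 0 i) ^+ 2.
  by apply: sumr_ge0 => i _; exact: sqr_ge0.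
rewrite (eq_bigr (fun i => enorm y ^+ 2 * x 0 i ^+ 2 + enorm x ^+ 2 * y 0 i ^+ 2
  - 2 * enorm x * enorm y * (x 0 i * y 0 i))) => [|i _]; last by ring.
rewrite sumrB big_split/= -!mulr_sumr -!sqr_enorm subr_ge0.
rewrite (_ : _ + _ = 2 * enorm x * enorm y * (enorm x * enorm y)); last by ring.
by rewrite ler_pM2l// !mulr_gt0.
Qed.

Lemma enormD x y : enorm (x + y) <= enorm x + enorm y.
Proof.
rewrite -(@ler_pXn2r _ 2)// ?nnegrE ?addr_ge0 ?enorm_ge0//.
rewrite sqr_enorm sqrrD !sqr_enorm.
rewrite (eq_bigr (fun i => x 0 i ^+ 2 + (x 0 i * y 0 i) *+ 2 + y 0 i ^+ 2)).
  rewrite !big_split/= -mulr2n lerD2r lerD2l ler_pMn2r//; exact: enorm_dot.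
by move=> i _; rewrite mxE sqrrD.
Qed.

Lemma enormN x : enorm (- x) = enorm x.
Proof. by rewrite -scaleN1r enormZ normrN1 mul1r. Qed.

Lemma enorm_sum (I : Type) (r : seq I) (P : pred I) (F : I -> 'rV[R]_n) :
  enorm (\sum_(i <- r | P i) F i) <= \sum_(i <- r | P i) enorm (F i).
Proof.
elim/big_ind2 : _ => //; first by rewrite enorm0.
by move=> x a y b xa yb; apply: le_trans (enormD _ _) _; exact: lerD.
Qed.

Lemma enorm_le_max x : enorm x <= n%:R * `|x|.
Proof.
rewrite -(@ler_pXn2r _ 2)// ?nnegrE ?mulr_ge0 ?enorm_ge0//.
rewrite sqr_enorm exprMn; apply: (@le_trans _ _ (\sum_(i < n) `|x| ^+ 2)).
  apply: ler_sum => i _; rewrite -[leLHS]real_normK ?num_real//.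
  rewrite ler_pXn2r ?nnegrE//.
  rewrite [leRHS]/Num.Def.normr/= mx_normrE.
  by apply/bigmax_geP; right => /=; exists (0, i).
rewrite sumr_const card_ord -[leLHS]mulr_natl ler_wpM2r ?sqr_ge0//.
by case: n => [|k]; rewrite ?expr0n//= -natrX ler_nat leq_pmulr.
Qed.

Lemma open_eball x (r : R) : open (eball x r).
Proof.
rewrite openE => y; rewrite /eball/= => xy; apply/nbhs_ballP.
exists ((r - enorm (y - x)) / n.+1%:R) => /=; first by rewrite divr_gt0 ?subr_gt0.
move=> z; rewrite -ball_normE /= => yz.
rewrite -(subrK y z) -addrA; apply: le_lt_trans (enormD _ _) _.
rewrite -ltrBrDr; apply: le_lt_trans (enorm_le_max _) _.
rewrite distrC; rewrite ltr_pdivlMr// in yz; apply: le_lt_trans yz.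
by rewrite mulrC ler_wpM2l// ler_nat.
Qed.

End euclidean_norm.

Lemma enorm_mul_orthonormal (R : realType) (k n : nat) (F : 'M[R]_(k, n)) (z : 'rV[R]_k) :
  F *m F^T = 1%:M -> enorm (z *m F) = enorm z.
Proof.
move=> FF; have E p (x : 'rV[R]_p) : \sum_i x 0 i ^+ 2 = (x *m x^T) 0 0.
  by rewrite mxE; apply: eq_bigr => i _; rewrite mxE expr2.
by rewrite /enorm !E trmx_mul mulmxA -(mulmxA z) FF mulmx1.
Qed.

Section simplex.
Variables (R : realType) (k n : nat) (V : 'M[R]_(k, n)).

Lemma conv_hull_row i : conv_hull V (row i V).
Proof.
exists (delta_mx 0 i); last by rewrite -rowE.
split=> [j|]; first by rewrite mxE eqxx/= ler0n.
rewrite (bigD1 i)//= mxE !eqxx/= big1 ?addr0// => j ji.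
by rewrite mxE (negbTE ji) andbF.
Qed.

Lemma convex_conv_hull : convex_set (conv_hull V).
Proof.
move=> _ _ t [c [c0 c1] <-] [e [e0 e1] <-] /andP[t0 t1].
exists (c + t *: (e - c)); last by rewrite mulmxDl -scalemxAl mulmxBl.
split=> [i|].
  rewrite !mxE (_ : _ + _ = (1 - t) * c 0 i + t * e 0 i); last by ring.
  by rewrite addr_ge0// mulr_ge0// subr_ge0.
rewrite (eq_bigr (fun i => (1 - t) * c 0 i + t * e 0 i)); last first.
  by move=> i _; rewrite !mxE; ring.
by rewrite big_split/= -!mulr_sumr c1 e1; ring.
Qed.

Lemma enorm_conv_hull x : conv_hull V x -> enorm x <= \sum_i enorm (row i V).
Proof.
move=> [c [c0 c1] <-]; rewrite mulmx_sum_row; apply: le_trans (enorm_sum _ _ _) _.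
apply: ler_sum => i _; rewrite enormZ ger0_norm// -[leRHS]mul1r.
rewrite ler_wpM2r ?enorm_ge0// -c1 (bigD1 i)//= lerDl.
by apply: sumr_ge0 => j _.
Qed.

Let K := (conv_hull V)°.

Lemma enorm_le_diam x y : K x -> K y -> enorm (x - y) <= diam K.
Proof.
move=> Kx Ky; apply: ub_le_sup; last by exists x => //; exists y.
exists (\sum_i enorm (row i V) + \sum_i enorm (row i V)) => _ [a Ka] [b Kb] <-.
apply: le_trans (enormD _ _) _; rewrite enormN.
by apply: lerD; apply: enorm_conv_hull; exact: interior_subset.
Qed.

Lemma diam_gt0 x : (0 < n)%N -> K x -> 0 < diam K.
Proof.
move=> n0 Kx; have /nbhs_ballP[e /= e0 eK] : nbhs x K.
  by apply: open_nbhs_nbhs; split => //; exact: open_interior.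
pose i0 := Ordinal n0; pose d : 'rV[R]_n := delta_mx 0 i0.
have d1 : enorm d = 1.
  rewrite /enorm (bigD1 i0)//= mxE !eqxx expr1n big1 ?addr0 ?sqrtr1// => j ji.
  by rewrite mxE (negbTE ji) andbF expr0n.
have d2 : `|d| <= 1.
  rewrite [leLHS]/Num.Def.normr/= mx_normrE bigmax_le// => -[i j] _ /=.
  by rewrite mxE; case: (_ && _); rewrite ?normr1 ?normr0.
apply: (@lt_le_trans _ _ (enorm (x + (e / 2) *: d - x))); last first.
  apply: enorm_le_diam => //; apply: eK; rewrite -ball_normE /=.
  rewrite opprD addNKr normrN normrZ gtr0_norm ?divr_gt0//.
  apply: le_lt_trans (ler_piMr _ d2) _; first by rewrite ltW ?divr_gt0.
  by rewrite gtr_pMr// invf_lt1// ltr1n.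
by rewrite addrAC subrr add0r enormZ d1 mulr1 normr_gt0 gt_eqF// divr_gt0.
Qed.

(** The vertices are not in the open simplex, only limits of its points
    [(1 - t) V_i + t x] as [t] tends to [0]. *)
Lemma enorm_vertices x i j : K x -> enorm (row i V - row j V) <= diam K.
Proof.
move=> Kx; have /nbhs_ballP[e /= e0 eK] : nbhs x (conv_hull V) by [].
pose p t i := row i V + t *: (x - row i V).
have Kp t l : 0 < t <= 1 -> K (p t l).
  move=> t01; apply/nbhs_ballP; exists (t * e) => /=.
    by case/andP: t01 => t0 _; exact: mulr_gt0.
  apply: convex_ball => //; [exact: convex_conv_hull|exact: conv_hull_row].
have le_diam t : 0 < t <= 1 -> (1 - t) * enorm (row i V - row j V) <= diam K.
  move=> t01; have := enorm_le_diam (Kp t i t01) (Kp t j t01).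
  rewrite (_ : p t i - p t j = (1 - t) *: (row i V - row j V)).
    by rewrite enormZ ger0_norm// subr_ge0; case/andP: t01.
  by rewrite /p; apply/rowP => l; rewrite !mxE; ring.
rewrite leNgt; apply/negP; set E := enorm _ in le_diam * => dE.
have d0 : 0 <= diam K.
  by have := @enorm_le_diam x x Kx Kx; rewrite subrr enorm0.
have E0 : 0 < E by exact: le_lt_trans dE.
(* For this [t], [(1 - t) * E] is the midpoint of [diam K] and [E]. *)
have := le_diam ((1 - diam K / E) / 2).
have dE1 : diam K / E < 1 by rewrite ltr_pdivrMr// mul1r.
have dE0 : 0 <= diam K / E by rewrite divr_ge0// ltW.
move=> /(_ _)/wrap[].
  by apply/andP; split; lra.
have {2}-> : diam K = diam K / E * E by rewrite divfK ?gt_eqF.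
rewrite ler_pM2r// => ?; lra.
Qed.

(** By convexity of the norm it is enough to treat a vertex [V_i], for which
    [V_i - barycenter V] is [1 / k] times the sum of the [k - 1] edges
    [V_i - V_j]. *)
Lemma enorm_barycenter x : K x ->
  enorm (x - barycenter V) <= k.-1%:R / k%:R * diam K.
Proof.
move=> Kx; have [c [c0 c1] cx] := interior_subset Kx.
have k0 : (0 < k)%N.
  case: k V c c0 c1 {cx Kx} => // ? c _ /eqP; rewrite big_ord0 eq_sym oner_eq0//.
have k0' : k%:R != 0 :> R by rewrite pnatr_eq0 -lt0n.
have VB i : enorm (row i V - barycenter V) <= k.-1%:R / k%:R * diam K.
  rewrite (_ : _ - _ = k%:R^-1 *: \sum_(j < k | j != i) (row i V - row j V)).
    rewrite enormZ ger0_norm// mulrC mulrAC ler_wpM2r ?invr_ge0//.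
    apply: le_trans (enorm_sum _ _ _) _.
    apply: (@le_trans _ _ (\sum_(j < k | j != i) diam K)).
      by apply: ler_sum => j _; exact: enorm_vertices Kx.
    by rewrite sumr_const cardC1 card_ord mulr_natl.
  rewrite sumrB sumr_const cardC1 card_ord /barycenter (bigD1 i)//=.
  rewrite scalerBr scalerDr opprD addrA; congr (_ - _).
  apply: (scalerI k0'); rewrite scalerBr !scalerA !divff// !scale1r.
  have -> : k%:R = k.-1%:R + 1 :> R by rewrite natr1 prednK.
  by rewrite scalerDl scale1r addrK scaler_nat.
move: (_ * diam K) VB => B VB.
rewrite -cx (_ : _ - _ = \sum_i c 0 i *: (row i V - barycenter V)).
  apply: le_trans (enorm_sum _ _ _) _; rewrite -[leRHS]mul1r -c1 mulr_suml.
  by apply: ler_sum => i _; rewrite enormZ ger0_norm//; apply: ler_wpM2l.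
under eq_bigr do rewrite scalerBr.
by rewrite sumrB -scaler_suml c1 scale1r mulmx_sum_row.
Qed.

End simplex.

(** * Polynomials, norms and measures on the interface *)

Lemma line_poly_affine (R : realType) (m k n : nat) (f : 'rV[R]_n -> R)
    (o : 'rV[R]_n) (F : 'M[R]_(k, n)) :
  line_poly m f -> line_poly m (fun u => f (o + u *m F)).
Proof.
move=> fP x e; have [q sq qE] := fP (o + x *m F) (e *m F).
by exists q => // t; rewrite -qE mulmxDl -scalemxAl addrA.
Qed.

Lemma line_poly_meval (R : realType) (m d : nat) (p : mpoly.mpoly d R) :
  MPoly.degree_le m p ->
  line_poly m (fun x : 'rV[R]_d => mpoly.meval (fun i => x 0 i) p).
Proof.
move=> pm x e.
have [q sq qE] := MPolyLines.meval_line p (x 0) (e 0).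
exists q => [|t]; first exact: leq_trans sq pm.
by rewrite -qE; congr (mpoly.meval _ p); apply/funext => i; rewrite !mxE.
Qed.

Lemma continuous_meval (R : realType) (d : nat) (p : mpoly.mpoly d R) :
  continuous (fun x : 'rV[R]_d => mpoly.meval (fun i => x 0 i) p).
Proof.
have -> : (fun x : 'rV[R]_d => mpoly.meval (fun i => x 0 i) p) =
    fun x => \sum_(a <- mpoly.msupp p)
      mpoly.mcoeff a p * \prod_i x 0 i ^+ mpoly.fun_of_multinom a i.
  by apply/funext => x; rewrite mpoly.mevalE.
move=> x; have FF := nbhs_filter x.
apply: (@cvg_big _ _ _ _ _ _ _ (nbhs x) _ _ _ FF) => [|a _].
  exact: add_continuous.
apply: (@cvgM _ _ (nbhs x) FF); first exact: (@cvg_cst _ _ _ (nbhs x) FF).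
apply: (@cvg_big _ _ _ _ _ _ _ (nbhs x) _ _ _ FF) => [|i _].
  exact: mul_continuous.
have xi : y 0 i @[y --> x] --> x 0 i by exact: coord_continuous.
elim: (mpoly.fun_of_multinom a i) => [|l IH].
  rewrite expr0; under eq_fun do rewrite expr0.
  exact: (@cvg_cst _ _ _ (nbhs x) FF).
rewrite exprS; under eq_fun do rewrite exprS.
exact: (@cvgM _ _ (nbhs x) FF _ _ _ _ xi IH).
Qed.

Lemma continuous_measurable_rV (R : realType) (n : nat) (f : 'rV[R]_n -> R) :
  continuous f -> measurable_fun setT f.
Proof.
move=> cf; apply: (measurability _ (RGenOpens.measurableE R)).
move=> _ [_ [a [b ->] <-]].
rewrite setTI; apply: open_measurable_mx; apply: open_comp => [v _|].
  exact: cf.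
exact: interval_open.
Qed.

Lemma compact_side_set (R : realType) (d : nat) (s : side R d) : compact (side_set s).
Proof.
apply: continuous_compact; first exact/continuous_subspaceT/continuous_chart.
apply: bounded_closed_compact; last exact: closed_closure.
have [_ _ _ [M [Mr DM]] _] := shape_polyhedral s.
exists M; split => // x Mx.
have cx : closed [set y : 'rV[R]_d.-1 | `|y| <= x].
  apply: (@closed_comp _ _ _ [set r : R | r <= x]) => [y _|].
    exact: norm_continuous.
  exact: closed_le.
by move=> y Dy; apply: cx; apply: closureS Dy; exact: DM.
Qed.

Lemma measurable_ball_part (R : realType) (d J : nat) (Gam : 'I_J -> side R d)
    (V : 'M[R]_(d.+1, d)) : measurable (ball_part Gam V).
Proof.
apply: fin_bigcup_measurable; first exact: finite_finset.
move=> j _; apply: measurableI.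
  apply: closed_measurable_mx; apply: compact_closed; first exact: norm_hausdorff.
  exact: compact_side_set.
by apply: open_measurable_mx; exact: open_eball.
Qed.

(** Chebyshev's inequality for [|w| ^ 2]. *)
Lemma Lnorm_on2_ge (R : realType) dT (T : measurableType dT)
    (mu : {measure set T -> \bar R}) (A : set T) (w : T -> R) (a b : R) :
  measurable A -> measurable_fun setT (patch (fun=> 0) A w) -> 0 < a -> 0 <= b ->
  (b%:E <= mu (A `&` [set x | a <= `|w x|]%R))%E ->
  ((a * Num.sqrt b)%:E <= Lnorm_on mu 2%:E A w)%E.
Proof.
move=> mA mw a0 b0 bmu; rewrite /Lnorm_on unlock.
set g := EFin \o _; have mg : measurable_fun setT (g : T -> \bar R).
  exact: measurableT_comp.
have ap (x : R) : 0 <= x -> x `^ 2 = x ^+ 2 by move=> x0; rewrite -powR_mulrn.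
have := @le_integral_comp_abse _ _ _ mu setT measurableT _ a (poweR^~ 2)
  (measurable_poweR 2) (fun r _ => poweR_ge0 r 2) _ mg a0.
rewrite poweR_EFin (ap _ (ltW a0)) => H.
have {H} I : ((a ^+ 2 * b)%:E <= \int[mu]_x `|g x| `^ 2)%E.
  apply: le_trans (H _); last first.
    move=> x y; rewrite !inE/= !in_itv/= !andbT => x0 y0; apply: gt0_ler_poweR => //.
    by rewrite in_itv/= x0 leey.
    by rewrite in_itv/= y0 leey.
  rewrite EFinM; apply: lee_wpmul2l; first by rewrite lee_fin sqr_ge0.
  apply: le_trans bmu _; rewrite setTI.
  have -> : A `&` [set x | a <= `|w x|] = A `&` [set x | a <= `|patch (fun=> 0) A w x|].
    by apply/seteqP; split => x /= [Ax]; rewrite patchE (mem_set Ax).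
  have mB : measurable [set x | a <= `|patch (fun=> 0) A w x|].
    rewrite -[X in measurable X]setTI; apply: measurable_fun_le => //.
    exact: measurableT_comp.
  rewrite (_ : [set x | _] = [set x | a <= `|patch (fun=> 0) A w x|]).
    by apply: le_measure; rewrite ?inE//; exact: measurableI.
  by apply/seteqP; split => x /=; rewrite lee_fin.
rewrite [leLHS](_ : _ = ((a ^+ 2 * b)%:E `^ 2^-1)%E); last first.
  rewrite poweR_EFin powR12_sqrt; last by rewrite mulr_ge0 ?sqr_ge0.
  by rewrite sqrtrM ?sqr_ge0// sqrtr_sqr gtr0_norm.
apply: gt0_ler_poweR I; rewrite ?invr_ge0//.
  by rewrite in_itv/= leey andbT lee_fin mulr_ge0 ?sqr_ge0.
rewrite in_itv; apply/andP; split; last exact: leey.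
by apply: integral_ge0 => x _; exact: poweR_ge0.
Qed.

Lemma Lnorm_on_oo_le (R : realType) dT (T : measurableType dT)
    (mu : {measure set T -> \bar R}) (A : set T) (w : T -> R) (B : \bar R) :
  (0 <= B)%E -> (forall x, A x -> (`|w x|%:E <= B)%E) ->
  (Lnorm_on mu +oo A w <= B)%E.
Proof.
move=> B0 AB; rewrite /Lnorm_on unlock; case: ifP => // _.
apply/ess_supP; apply: aeW => x /=.
by rewrite patchE; case: ifPn => [/set_mem/AB//|_]; rewrite normr0.
Qed.

Lemma le_surface_measure (R : realType) (d J : nat) (Gam : 'I_J -> side R d) j
    (A : set 'rV[R]_d) :
  (lebesgue_rV R d.-1 (closure (Defs.shape (Gam j)) `&` chart (Gam j) @^-1` A)
   <= surface_measure Gam A)%E.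
Proof.
by rewrite /surface_measure (bigD1 j)//= leeDl// sume_ge0.
Qed.

Lemma element_diam_le_mesh_size (R : realType) (d N : nat)
    (T : 'I_N -> 'M[R]_(d.+1, d)) k : element_diam (T k) <= mesh_size T.
Proof.
apply: ub_le_sup; last by exists k.
exists (\sum_i `|element_diam (T i)|) => _ [i _ <-].
by rewrite (bigD1 i)//= (le_trans (ler_norm _))// lerDl sumr_ge0.
Qed.

Lemma measurable_patch_eq (R : realType) dT (T : measurableType dT)
    (A : set T) (w f : T -> R) :
  measurable A -> measurable_fun setT f -> {in A, w =1 f} ->
  measurable_fun setT (patch (fun=> 0) A w).
Proof.
move=> mA mf wf; rewrite (_ : patch _ A w = patch (fun=> 0) A f).
  by apply/(measurable_restrictT _ mA); exact: measurable_funTS.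
apply/funext => x; rewrite !patchE; case: ifPn => // xA; exact: wf.
Qed.

Lemma enorm_chartB (R : realType) (d : nat) (s : side R d) (u v : 'rV[R]_d.-1) :
  enorm (chart s u - chart s v) = enorm (u - v).
Proof.
rewrite /chart opprD addrACA subrr add0r -mulmxBl.
exact/enorm_mul_orthonormal/frame_orthonormal.
Qed.

Lemma powR_half_dim (R : realType) (d : nat) (h : R) : (0 < d)%N -> 0 < h ->
  h `^ ((1 - d%:R) / 2) = (Num.sqrt (h ^+ d.-1))^-1.
Proof.
move=> d0 h0; rewrite (_ : (1 - d%:R) / 2 = - (d.-1%:R / 2)); last first.
  by rewrite -{1}(prednK d0) -natr1 opprD addrCA subrr addr0 mulNr.
by rewrite powRN powRrM powR_mulrn ?ltW// powR12_sqrt// exprn_ge0// ltW.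
Qed.

(** * The trace estimate *)

Theorem lemma2 (R : realType) (d : nat) (hd : d = 2%N \/ d = 3%N)
    (m : nat) (hm : (1 <= m)%N)
    (Omega : set 'rV[R]_d) (Omega_ : 'I_2 -> set 'rV[R]_d)
    (J : nat) (Gam : 'I_J -> side R d) (Cnu : R) :
  polyhedral_domain Omega ->
  is_polyhedral_interface Omega Omega_ Gam ->
  exists h1 C : R, [/\ 0 < h1, 0 < C &
    forall (N : nat) (T : 'I_N -> 'M[R]_(d.+1, d)),
      is_admissible_mesh Cnu Omega Omega_ (sides_union Gam) T ->
      mesh_size T < h1 ->
      forall k : 'I_N, is_cut (sides_union Gam) (T k) ->
      forall w : 'rV[R]_d -> R, poly_le m (barycentric_ball (T k)) w ->
        (Lnorm_on (surface_measure Gam) +oo (cut_part (sides_union Gam) (T k)) w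
         <= (C * element_diam (T k) `^ ((1 - d%:R) / 2))%:E
            * Lnorm_on (surface_measure Gam) 2%:E (ball_part Gam (T k)) w)%E].
Proof.
move=> _ _.
have d1 : (1 < d)%N by case: hd => ->.
have d0 : (0 < d)%N by exact: ltnW.
have n0 : (0 < d.-1)%N by rewrite -subn1 subn_gt0.
have [c [c0 cP]] : exists c : R, 0 < c /\ forall j : 'I_J, forall u r,
    closure (Defs.shape (Gam j)) u -> 0 < r <= 1 ->
    exists2 v, ball v (c * r) `<=` Defs.shape (Gam j) & ball v (c * r) `<=` ball u r.
  have cj j := corkscrew n0 (shape_polyhedral (Gam j)).
  have cJ := filter_forall _ cj.
  have [c [c0 cP]] := filter_ex (filterI (nbhs_right_gt (0 : R)) (cJ _)).
  by exists c.
have ci0 : 0 < c^-1 by rewrite invr_gt0.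
have [kappa [eps [k0 e0 remezP]]] := remez_cube m ci0.
have dd0 : 0 < (d * d.+1)%:R :> R by rewrite ltr0n muln_gt0 d0.
pose K := eps * c / (d * d.+1)%:R.
have K0 : 0 < K by rewrite divr_gt0// mulr_gt0.
pose C := (kappa ^+ d.-1 * Num.sqrt (K ^+ d.-1))^-1.
have C0 : 0 < C by rewrite invr_gt0 mulr_gt0 ?exprn_gt0 ?sqrtr_gt0 ?exprn_gt0.
exists 1, C; split => // N T _ h1 k [x0 [Kx0 _]] w [p [pm wp]].
set h := element_diam (T k).
have h0 : 0 < h by exact: diam_gt0 Kx0.
have {}h1 : h < 1 by apply: le_lt_trans h1; exact: element_diam_le_mesh_size.
pose f (x : 'rV[R]_d) : R := mpoly.meval (fun i => x 0 i) p.
have mf : measurable_fun setT f.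
  by apply: continuous_measurable_rV; exact: continuous_meval.
have Ch0 : 0 < C * h `^ ((1 - d%:R) / 2) by rewrite mulr_gt0// powR_gt0.
have mA := measurable_ball_part Gam (T k).
have ball_sub : ball_part Gam (T k) `<=` barycentric_ball (T k).
  by move=> y [j _ []].
have wf : {in ball_part Gam (T k), w =1 f}.
  by move=> y /set_mem/ball_sub/wp.
apply: Lnorm_on_oo_le => [|x [Kx [j _ [u Du ux]]]].
  by rewrite mule_ge0 ?lee_fin ?(ltW Ch0)//; exact: Lnorm_ge0.
have [->|wx0] := eqVneq (w x) 0.
  by rewrite normr0 mule_ge0 ?lee_fin ?(ltW Ch0)//; exact: Lnorm_ge0.
have xbar := enorm_barycenter Kx.
have wxf : w x = f x.
  apply: wp; apply: le_lt_trans xbar _; rewrite gtr_pMl//.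
  by rewrite ltr_pdivrMr ?ltr0Sn// mul1r ltr_nat.
(* The max-norm ball of radius [r] around [u] is in the Euclidean ball of radius
   [(d - 1) * r < h / (d + 1)], the room left around [x]. *)
pose r := h / (d * d.+1)%:R.
have r0 : 0 < r by rewrite divr_gt0.
have r1 : r <= 1.
  rewrite ler_pdivrMr// mul1r; apply: le_trans (ltW h1) _.
  by rewrite ler1n muln_gt0 d0.
have [v vD vu] := cP j u r Du (introT andP (conj r0 r1)).
have s0 : 0 < c * r by rewrite mulr_gt0.
pose g (y : 'rV[R]_d.-1) := f (chart (Gam j) y).
have mg : measurable_fun setT g.
  apply: continuous_measurable_rV => y.
  apply: continuous_comp; [exact: continuous_chart|exact: continuous_meval].
have gP : line_poly m g by apply: line_poly_affine; exact: line_poly_meval.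
have uv i : `|u 0 i - v 0 i| <= c^-1 * (c * r).
  rewrite mulrA mulVf ?gt_eqF// mul1r; apply: ltW.
  by have [_] := vu v (ballxx _ s0); apply.
have := remezP _ g v u _ mg gP s0 uv.
set B := [set y | _] => Bmu.
set a := kappa ^+ d.-1 * `|w x|.
have a0 : 0 < a by rewrite mulr_gt0 ?exprn_gt0 ?normr_gt0.
have L2 : ((a * Num.sqrt ((K * h) ^+ d.-1))%:E <=
    Lnorm_on (surface_measure Gam) 2%:E (ball_part Gam (T k)) w)%E.
  apply: Lnorm_on2_ge => //; first exact: measurable_patch_eq mf wf.
    by rewrite exprn_ge0// mulr_ge0 ?ltW.
  rewrite (_ : K * h = eps * (c * r)); last by rewrite /K /r; ring.
  apply: le_trans Bmu _; apply: le_trans (le_surface_measure Gam j _).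
  apply: le_measure; rewrite ?inE.
  - exact: measurable_ball_superlevel.
  - apply: measurableI.
      by apply: closed_measurable_mx; exact: closed_closure.
    rewrite -[X in measurable X]setTI.
    apply: continuous_measurable_mx => //; first exact: continuous_chart.
    rewrite (_ : _ `&` _ = ball_part Gam (T k) `&` [set x | a <= `|f x|]).
      apply: measurableI => //; rewrite -[X in measurable X]setTI.
      by apply: measurable_fun_le => //; exact: measurableT_comp.
    by apply/seteqP; split => z /= [zA]; rewrite (wf _ (mem_set zA)).
  move=> y [vy gy]; split; first exact/subset_closure/vD.
  have yball : barycentric_ball (T k) (chart (Gam j) y).
    have yu : enorm (chart (Gam j) y - x) < d.-1%:R * r.
      rewrite -ux enorm_chartB; apply: le_lt_trans (enorm_le_max _) _.
      rewrite ltr_pM2l ?ltr0n// distrC.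
      by have := vu _ vy; rewrite -ball_normE.
    rewrite /barycentric_ball /eball /= -(subrK x (chart _ y)).
    rewrite -addrA; apply: le_lt_trans (enormD _ _) _.
    apply: lt_le_trans (ltr_leD yu xbar) _; rewrite -/(element_diam _) -/h /r /=.
    have -> : d.-1%:R = d%:R - 1 :> R by rewrite -[in RHS](prednK d0) -natr1 addrK.
    have D0 : 0 < d%:R :> R by rewrite ltr0n.
    have D1 : 0 < d%:R + 1 :> R by rewrite addr_gt0.
    rewrite natrM -natr1 -subr_ge0 (_ : _ - _ = h / (d%:R * (d%:R + 1))).
      by rewrite divr_ge0 ?ltW// mulr_gt0.
    by field; rewrite !gt_eqF.
  have yA : ball_part Gam (T k) (chart (Gam j) y).
    exists j; first by exists x; split => //; exists u.
    by split => //; exists y => //; exact/subset_closure/vD.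
  by split => //=; rewrite /a wxf (wf _ (mem_set yA)) -ux.
apply: le_trans (lee_wpmul2l _ L2); last by rewrite lee_fin ltW.
rewrite -EFinM lee_fin powR_half_dim// exprMn sqrtrM ?exprn_ge0 ?(ltW K0)//.
rewrite /a /C le_eqVlt; apply/orP; left; apply/eqP; field.
by rewrite !gt_eqF ?sqrtr_gt0 ?exprn_gt0.
Qed.
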